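(* $\mathfrak{sp}(\text{Borel}) = \mathfrak{sp}(\mathbf{\Sigma}^1_1) = \mathfrak{sp}(\mathbf{\Pi}^1_1) = \mathfrak{sp}(\mathbf{\Sigma}^1_2) = \mathfrak{sp}(\aleph_1\text{-Suslin})$.
   Context: For a pointclass $\Gamma$ of subsets of $\mathbb{R}$, $\mathfrak{sp}(\Gamma) = \{|\mathcal{P}| : \mathcal{P} \text{ is a partition of } \mathbb{R} \text{ into uncountably many sets in } \Gamma\}$. Here $\mathbf{\Sigma}^1_1$ (analytic), $\mathbf{\Pi}^1_1$ (coanalytic), $\mathbf{\Sigma}^1_2$, and $\aleph_1$-Suslin are the standard boldface projective/Suslin pointclasses. *)

(* Defs.v *)
From HB Require Import structures.
From mathcomp Require Import all_boot all_order all_algebra.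
From mathcomp Require Import all_classical all_reals all_analysis.

Set Implicit Arguments.
Unset Strict Implicit.
Unset Printing Implicit Defensive.

Local Open Scope classical_set_scope.
Local Open Scope card_scope.

(* K^omega with the product topology, K being discrete. *)
Definition seq_space (K : choiceType) : topologicalType :=
  prod_topology (fun _ : nat => discrete_topology K).

Definition Baire_space : topologicalType := seq_space nat.

Definition projection (X Y : topologicalType) (Gamma : set (set (X * Y))) :
    set (set X) :=
  [set fst @` C | C in Gamma].

Section Pointclasses.
Variable X : topologicalType.

Definition Borel : set (set X) := <<s [set U : set X | open U] >>.

Definition Sigma11 : set (set X) :=
  projection [set C : set (X * Baire_space) | closed C].

Definition Pi11 : set (set X) := [set A | Sigma11 (~` A)].

(* A is K-Suslin when it is the projection of a closed subset of X x K^omega;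
   only the cardinality of K matters. *)
Definition Suslin (K : choiceType) : set (set X) :=
  projection [set C : set (X * seq_space K) | closed C].

End Pointclasses.

Arguments Borel : clear implicits.
Arguments Sigma11 : clear implicits.
Arguments Pi11 : clear implicits.
Arguments Suslin : clear implicits.

Definition Sigma12 (X : topologicalType) : set (set X) :=
  projection (Pi11 (X * Baire_space)%type).

Arguments Sigma12 : clear implicits.

(* K has the least uncountable cardinality: it is uncountable, and all smaller
   cardinalities are countable. *)
Definition is_aleph1 (K : Type) : Prop :=
  ~ countable [set: K] /\ forall A : set K, countable A \/ A #= [set: K].

Definition aleph1_Suslin (X : topologicalType) : set (set X) :=
  [set A | exists2 K : choiceType, is_aleph1 K & Suslin X K A].

Arguments aleph1_Suslin : clear implicits.

(* The cardinal |A|, as the equinumerosity class of A among the subsets of T, so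
   that cardinality A = cardinality B if and only if A #= B. *)
Definition cardinality (T : Type) (A : set T) : set (set T) :=
  [set B | B #= A].

(* partition P id setT: the members of P are nonempty and pairwise disjoint, and
   they cover X. *)
Definition sp (X : topologicalType) (Gamma : set (set X)) :
    set (set (set (set X))) :=
  [set cardinality P | P in
    [set P : set (set X) |
      [/\ partition P id [set: X], ~ countable P & P `<=` Gamma]]].

(* Main.v *)
Require Import Defs.
From mathcomp Require Import all_boot all_order all_algebra.
From mathcomp Require Import all_classical all_reals all_analysis.
From mathcomp Require Import wochoice borel_hierarchy.
Import Order.TTheory GRing.Theory Num.Theory.
Import numFieldNormedType.Exports.

(* Everything lies between the Borel and the aleph_1-Suslin pointclass; for
   Sigma^1_2 the upper bound is the Martin-Solovay tree of rank functions into
   omega_1. So it is enough to refine a partition [P] into aleph_1-Suslin sets to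
   a Borel partition of the same cardinality. A witness in omega_1^omega is
   bounded, hence an aleph_1-Suslin set is a union of aleph_1 analytic sets. An
   analytic set is a union of aleph_1 Borel sets: prune the tree of attempts at
   [x] transfinitely; it stabilizes at some countable stage, and being stable
   with a surviving root at stage [a] is a Borel condition on [x]. A union of
   aleph_1 Borel sets can be made disjoint, since initial segments of omega_1 are
   countable. The refinement has at most |P| * aleph_1 = |P| members. *)

Set Implicit Arguments.
Unset Strict Implicit.
Unset Printing Implicit Defensive.
Local Open Scope classical_set_scope.
Local Open Scope card_scope.

(** * Cardinal arithmetic and omega_1 *)

(** Cardinal comparison at the level of types, so that sets coerced to types and products are
    handled by plain functions. *)
Definition embeds (T U : Type) := exists f : T -> U, injective f.

Lemma embeds_trans (U T V : Type) : embeds T U -> embeds U V -> embeds T V.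
Proof. by move=> [f fI] [g gI]; exists (g \o f); exact: inj_comp. Qed.

Lemma card_le_embeds (T U : Type) (A : set T) (B : set U) :
  A #<= B <-> embeds A B.
Proof.
split=> [/card_leP[f]|[f fI]].
  by exists f => x y; apply: (inj (f := f)); rewrite inE.
have /inj_card_eq fA : {in [set: A] &, injective f} by move=> x y _ _; exact: fI.
rewrite -(card_le_eqr (card_setT B)) -(card_le_eql (card_setT A)).
by rewrite -(card_le_eql fA); exact: card_leT.
Qed.

Lemma embeds_setT (T U : Type) : embeds T U <-> [set: T] #<= [set: U].
Proof.
split=> [[f fI]|/card_le_embeds[f fI]].
  have /inj_card_eq fT : {in [set: T] &, injective f} by move=> x y _ _; exact: fI.
  by rewrite -(card_le_eql fT); exact: card_leT.
exists (fun x => val (f (SigSub (mem_set (I : [set: T] x))))) => x y.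
by move=> /val_inj/fI[].
Qed.

Lemma embeds_surj (T U : Type) (u : U) :
  embeds U T -> exists f : T -> U, forall y, exists x, f x = y.
Proof.
move=> [f fI].
have H t : exists u', forall v, f v = t -> u' = v.
  have [[v <-]|n] := pselect (exists v, f v = t); first by exists v => w /fI.
  by exists u => v fv; case: n; exists v.
have [g gP] := choice H.
by exists g => y; exists (f y); exact: gP.
Qed.

(** Zorn's lemma on graphs of partial bijections: a maximal one is total on one side, since
    otherwise a pair of unmatched points would extend it. *)
Lemma embeds_total (T U : Type) : embeds T U \/ embeds U T.
Proof.
pose P (G : set (T * U)) := forall p q, G p -> G q -> p.1 = q.1 <-> p.2 = q.2.
have [|G [PG maxG]] := @Zorn_bigcup _ P.
  move=> F FP totF p q [X FX Xp] [Y FY Yq].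
  have [XY|YX] := totF _ _ FX FY.
  - by apply: (FP _ FY) => //; exact: XY.
  - by apply: (FP _ FX) => //; exact: YX.
have [allT|/existsNP[t nt]] := pselect (forall t, exists u, G (t, u)).
  left; have [f fP] := choice allT; exists f => x y fxy.
  by apply/(PG _ _ (fP x) (fP y)).
have [allU|/existsNP[u nu]] := pselect (forall u, exists t, G (t, u)).
  right; have [f fP] := choice allU; exists f => x y fxy.
  by apply/(PG _ _ (fP x) (fP y)).
exfalso; apply: (maxG (G `|` [set (t, u)])).
  split; first by move=> x Gx; left.
  by move=> /(_ (t, u) (or_intror erefl)) Gtu; apply: nt; exists u.
move=> [a b] [c d] [Gab|[-> ->]] [Gcd|[-> ->]] //=.
- exact: PG Gab Gcd.
- split=> e; [case: nt|case: nu]; [exists b|exists a]; by rewrite -e.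
- split=> e; [case: nt|case: nu]; [exists d|exists c]; by rewrite e.
Qed.

(* A maximal disjoint family of copies of [M] in [K] leaves a remainder that
   embeds in [M], so [K] is covered by two copies of (family) * [M]. *)
Lemma embeds_absorb (M K : Type) :
  embeds bool M -> embeds (M * M) M -> embeds M K -> embeds (K * M) K.
Proof.
move=> [i iI] [j jI] [e eI].
have [E [Einj Edisj Emax]] := ex_maximal_disjoint_subcollection
  (fun h : M -> K => range h) [set h : M -> K | injective h].
pose rest := [set k | forall h, E h -> ~ range h k].
have norest (h : M -> K) : injective h -> range h `<=` rest -> False.
  move=> hI hrest; apply: (Emax (E `|` [set h])).
  - split; first by move=> x; left.
    move=> /(_ h (or_intror erefl)) Eh.
    by case: (hrest (h (i true)) (imageP _ I) h Eh).
  - by move=> x [/Einj//|->].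
  - move=> a b [Ea|->] [Eb|->] //; first exact: Edisj.
    + by move=> [x [ax hx]]; case: (hrest _ hx _ Ea ax).
    + by move=> [x [hx bx]]; case: (hrest _ hx _ Eb bx).
have [h0 Eh0] : exists h0, E h0.
  apply: contrapT => nE; apply: (norest e eI) => k _ h Eh.
  by case: nE; exists h.
have [r rI] : embeds rest M.
  have [//|[f fI]] := embeds_total rest M; exfalso.
  apply: (norest (fun m => val (f m))); first by move=> x y /val_inj/fI.
  by move=> _ [m _ <-]; exact: set_valP.
(* In a code [(h, m, b)] of [k], a true [b] means that [k] lies in [rest] and [m] is its image under
   [r], with [h0] as a dummy [h]; a false [b] means [h m = k]. *)
have code k : exists c : (M -> K) * M * bool, E c.1.1 /\
    (if c.2 then exists s : rest, val s = k /\ r s = c.1.2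
     else c.1.1 c.1.2 = k).
  have [krest|] := pselect (rest k).
    exists (h0, r (SigSub (mem_set krest)), true); split=> //=.
    by exists (SigSub (mem_set krest)).
  move=> /existsNP[h /not_implyP[Eh /contrapT[m _ hm]]].
  by exists (h, m, false).
have [c cP] := choice code.
(* The rest of the code of [k] and the second component are packed into one point of the copy [h];
   since the copies are disjoint, the value determines [h]. *)
exists (fun p => (c p.1).1.1 (j (j ((c p.1).1.2, i (c p.1).2), p.2))).
move=> [k m] [k' m'] /=.
case: (c k) (cP k) => -[h a] b /= [Eh ck].
case: (c k') (cP k') => -[h' a'] b' /= [Eh' ck'] hh'.
have eh : h = h'.
  apply: Edisj => //.
  by exists (h (j (j (a, i b), m))); split; [|rewrite hh']; apply: imageP.
rewrite -{}eh in hh' ck'.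
move: (Einj _ Eh _ _ hh') => /jI[/jI[ea /iI eb] ->].
move: {hh'} b ck eb => [] + eb; rewrite -eb in ck'; move: ck'; last by move=> <- <-; rewrite ea.
by move=> [s [<- rs]] [s' [<- rs']]; congr (val _, _); apply: rI; rewrite rs rs'.
Qed.

Lemma embeds_nat2 : embeds (nat * nat) nat.
Proof. by exists pickle; exact: (pcan_inj pickleK). Qed.

Lemma uncountable_embeds_nat (K : Type) : ~ countable [set: K] -> embeds nat K.
Proof.
move=> ucK; apply/embeds_setT; apply/infiniteP => /finite_set_countable.
exact: ucK.
Qed.

Lemma uncountable_embeds_mul_nat (K : Type) :
  ~ countable [set: K] -> embeds (K * nat) K.
Proof.
move=> /uncountable_embeds_nat nK; apply: embeds_absorb nK.
  by exists nat_of_bool; case=> -[].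
exact: embeds_nat2.
Qed.

(** * Well-orders of type omega_1 *)

Definition omega1_order (K : Type) (lt : K -> K -> Prop) :=
  [/\ well_founded lt, forall y x z, lt x y -> lt y z -> lt x z,
      forall x y, [\/ x = y, lt x y | lt y x],
      forall x, countable [set y | lt y x] & ~ countable [set: K]].

Lemma well_order_lt (T : eqType) : exists lt : T -> T -> Prop,
  [/\ well_founded lt, forall y x z, lt x y -> lt y z -> lt x z &
      forall x y, [\/ x = y, lt x y | lt y x]].
Proof.
have [R Rwo] := @well_ordering_principle T.
have Rch : wo_chain R predT by move=> A _; exact: Rwo.
have Rtot x y : R x y || R y x by exact: (wo_chainW Rch).
have Ranti x y : R x y -> R y x -> x = y.
  by move=> xy yx; apply: (wo_chain_antisymmetric Rch) => //; rewrite xy.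
have Rtrans y x z : R x y -> R y z -> R x z.
  (* The least of [x], [y], [z] is [x], or else antisymmetry identifies two of them. *)
  move=> xy yz; have [|w [[wP wmin] _]] := Rwo [pred t | [|| t == x, t == y | t == z]].
    by exists x; rewrite inE eqxx.
  have wx : R w x by apply: wmin; rewrite inE eqxx.
  have wy : R w y by apply: wmin; rewrite inE eqxx orbT.
  have wz : R w z by apply: wmin; rewrite inE eqxx !orbT.
  move: wP; rewrite inE => /or3P[] /eqP e; rewrite {w wmin}e in wx wy wz => //.
    by rewrite (Ranti _ _ xy wx).
  by rewrite -(Ranti _ _ yz wy).
exists (fun x y => R x y /\ x <> y); split.
- move=> a; apply: contrapT => na.
  have [|z [[zP zmin] _]] := Rwo [pred t | `[< ~ Acc (fun x y => R x y /\ x <> y) t >]].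
    by exists a; apply/asboolP.
  move/asboolP: zP; apply; split=> y [yz nyz]; apply: contrapT => ny.
  by apply: nyz; apply: Ranti yz _; apply: zmin; apply/asboolP.
- move=> y x z [xy nxy] [yz nyz]; split; first exact: Rtrans yz.
  by move=> e; apply: nxy; apply: Ranti => //; rewrite e.
- move=> x y; have [->|/eqP nxy] := eqVneq x y; first exact: Or31.
  have /orP[xy|yx] := Rtot x y; first by apply: Or32.
  by apply: Or33; split=> // e; apply: nxy.
Qed.

Lemma countable_val (T : choiceType) (D : set T) (A : set D) :
  countable (val @` A) -> countable A.
Proof.
move=> /countable_injP[f fI]; apply/countable_injP.
exists (f \o val) => x y xA yA e; apply: val_inj.
by apply: fI e; rewrite inE; apply: imageP; apply: set_mem.
Qed.

(** In a well-order of [T], take the points with countably many predecessors. Were there only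
    countably many of them, the least remaining point would have all its predecessors among them and
    so be one itself. *)
Lemma omega1_exists (T : choiceType) : ~ countable [set: T] ->
  exists (K : choiceType) (lt : K -> K -> Prop), omega1_order lt /\ embeds K T.
Proof.
move=> ucT; have [lt [wf tr tri]] := well_order_lt T.
pose D := [set x | countable [set y | lt y x]].
have ucD : ~ countable D.
  have [allD|/existsNP[x0 nx0]] := pselect (forall x, D x).
    by rewrite (_ : D = [set: T])//; apply/seteqP; split.
  have [x [nx xmin]] : exists x, ~ D x /\ forall y, lt y x -> D y.
    elim/(well_founded_ind wf) : x0 nx0 => x IH nx.
    have [|/existsNP[y /not_implyP[yx ny]]] := pselect (forall y, lt y x -> D y).
      by exists x.
    exact: IH ny.
  move=> cD; apply: nx; apply: sub_countable cD.
  by apply: subset_card_le => y; exact: xmin.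
exists (set_type D : choiceType), (fun x y => lt (val x) (val y)).
split; last by exists val; exact: val_inj.
split.
- move=> x; move: {-1}(val x) (erefl (val x)) => v.
  elim/(well_founded_ind wf) : v x => v IH x e; split=> y yx.
  by apply: (IH (val y)) => //; rewrite -e.
- by move=> y x z; exact: tr.
- move=> x y; have [/val_inj ->|xy|yx] := tri (val x) (val y).
  + exact: Or31.
  + exact: Or32.
  + exact: Or33.
- move=> x; apply: countable_val; apply: sub_countable (set_valP x).
  by apply: subset_card_le => _ [y yx <-].
- by rewrite (eq_countable (card_setT D)).
Qed.

Section Omega1.
Variables (K : choiceType) (lt : K -> K -> Prop).
Hypothesis lt_omega1 : omega1_order lt.

Let wf : well_founded lt. Proof. by case: lt_omega1. Qed.
Let tr y x z : lt x y -> lt y z -> lt x z.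
Proof. by case: lt_omega1 => _ + _ _ _; apply. Qed.
Let tri x y : [\/ x = y, lt x y | lt y x].
Proof. by case: lt_omega1. Qed.
Let ucK : ~ countable [set: K]. Proof. by case: lt_omega1. Qed.

Lemma omega1_countable_le x : countable [set y | y = x \/ lt y x].
Proof.
have [_ _ _ /(_ x) cx _] := lt_omega1.
rewrite (_ : mkset _ = \bigcup_(b in [set: bool])
    (if b then [set x] else [set y | lt y x])).
  by apply: bigcup_countable => // -[] _ //; exact: countable1.
apply/seteqP; split=> y; first by case=> [->|]; [exists true|exists false].
by case=> -[] _ /=; [left|right].
Qed.

(** Regularity of omega_1: the initial segments below an unbounded countable set would cover [K] by
    countably many countable sets. *)
Lemma omega1_bounded (C : set K) :
  countable C -> exists b, forall c, C c -> lt c b.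
Proof.
move=> cC; apply: contrapT => /forallNP nb; apply: ucK.
rewrite (_ : [set: K] = \bigcup_(c in C) [set y | y = c \/ lt y c]).
  by apply: bigcup_countable => // c _; exact: omega1_countable_le.
apply/seteqP; split=> // b _.
have /existsNP[c /not_implyP[Cc ncb]] := nb b; exists c => //=.
by have [->|//|] := tri c b; [left|right].
Qed.

Lemma omega1_enum x : exists e : K -> nat,
  forall y z, (y = x \/ lt y x) -> (z = x \/ lt z x) -> e y = e z -> y = z.
Proof.
have /countable_injP[e eI] := omega1_countable_le x.
by exists e => y z yx zx; apply: eI; rewrite inE.
Qed.

(** A pair is coded by its larger entry and the index of the smaller one in an enumeration of the
    segment below; parity records which entry is larger. *)
Lemma omega1_mul : embeds (K * K) K.
Proof.
have [e eP] := choice omega1_enum.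
suff : embeds (K * K) (K * nat).
  by move=> h; apply: embeds_trans h _; exact: uncountable_embeds_mul_nat.
pose le (x y : K) := `[< x = y \/ lt x y >].
pose code (p : K * K) :=
  if le p.1 p.2 then (p.2, (e p.2 p.1).*2) else (p.1, (e p.1 p.2).*2.+1).
exists code => -[a b] [c d]; rewrite /code /=.
have nle x y : ~~ le x y -> y = x \/ lt y x.
  move/asboolPn => nxy; have [xy|xy|] := tri x y; last by right.
  - by case: nxy; left.
  - by case: nxy; right.
case: ifPn => ab; case: ifPn => cd [].
- move=> bd; rewrite -bd => /double_inj/eP ->//; first exact/asboolP.
  by rewrite bd; exact/asboolP.
- by move=> _ /(congr1 odd); rewrite /= !odd_double.
- by move=> _ /(congr1 odd); rewrite /= !odd_double.
- move=> ac; rewrite -ac => -/double_inj/eP ->//; first exact: nle.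
  by rewrite ac; exact: nle.
Qed.

(** An uncountable [A] is cofinal, so sending [x] to some [a] in [A] above it, with the index of [x]
    below [a], embeds [K] in [A * nat], hence in [A]. *)
Lemma omega1_is_aleph1 : is_aleph1 K.
Proof.
split=> // A; have [?|ucA] := pselect (countable A); [by left|right].
apply/card_eqPle; split; first exact: card_leT.
have ucA' : ~ countable [set: A] by rewrite (eq_countable (card_setT A)).
rewrite -(card_le_eqr (card_setT A)); apply/embeds_setT.
apply: embeds_trans (uncountable_embeds_mul_nat ucA').
have [e eP] := choice omega1_enum.
have H x : exists a : A, x = val a \/ lt x (val a).
  apply: contrapT => /forallNP na; apply: ucA.
  apply: sub_countable (omega1_countable_le x).
  apply: subset_card_le => a Aa.
  have /= := na (SigSub (mem_set Aa)).
  by have [->|//|] := tri x a; [move=> []; left|move=> ? []; right|right].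
have [f fP] := choice H.
exists (fun x => (f x, e (val (f x)) x)) => x y [fxy].
by rewrite -fxy => /eP; apply=> //; rewrite fxy.
Qed.

(** This lets one fixed copy of omega_1 replace any index type in the definition of aleph_1-Suslin
    sets. *)
Lemma is_aleph1_surj (K' : Type) : is_aleph1 K' ->
  exists f : K -> K', forall y, exists x, f x = y.
Proof.
move=> [ucK' K'P].
have [u _] : [set: K'] !=set0.
  by apply/set0P/eqP => e; apply: ucK'; rewrite e; exact: countable0.
apply: (embeds_surj u).
have [[f fI]|//] := embeds_total K K'.
have /inj_card_eq fK : {in [set: K] &, injective f} by move=> x y _ _; exact: fI.
have [cf|] := K'P (f @` [set: K]).
  by case: ucK; rewrite -(eq_countable fK).
by rewrite (card_eql fK) => /card_eqPle[_ /embeds_setT].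
Qed.

End Omega1.

(** * Suslin sets as projections of trees *)

Lemma mkseq_eq (T : Type) (g h : nat -> T) n :
  mkseq g n = mkseq h n <-> forall i, (i < n)%N -> g i = h i.
Proof.
split=> [e i lt_in|e]; last first.
  by apply/eq_in_map => i; rewrite mem_iota add0n => /andP[_ /e].
by rewrite -(nth_mkseq (g i) g lt_in) e nth_mkseq.
Qed.

Lemma take_mkseq (T : Type) (g : nat -> T) m n :
  (m <= n)%N -> take m (mkseq g n) = mkseq g m.
Proof. by move=> mn; rewrite /mkseq -map_take take_iota (minn_idPl mn). Qed.

Lemma mkseq0S (T : Type) (g : nat -> T) n :
  mkseq g n.+1 = g 0%N :: mkseq (fun m => g m.+1) n.
Proof. by rewrite /mkseq /= -[1%N]add1n iotaDl -map_comp. Qed.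

Lemma nbhs_cylinder (K : choiceType) (g : seq_space K) n :
  nbhs g [set h : seq_space K | mkseq h n = mkseq g n].
Proof.
elim: n => [|n IHn]; first exact: filterS filterT.
have gn : nbhs (g n : discrete_topology K) [set g n] by exact: discrete_set1.
have pn := @proj_continuous _ (fun _ : nat => discrete_topology K) n g _ gn.
apply: filterS (filterI IHn pn) => h [/mkseq_eq e1 /= e2].
by apply/mkseq_eq => i; rewrite ltnS leq_eqVlt => /predU1P[->//|/e1].
Qed.

(** The filter generated by the cylinders at [g] converges to [g] in each coordinate, hence in the
    product. *)
Lemma nbhs_seq_space (K : choiceType) (g : seq_space K) U :
  nbhs g U -> exists n, [set h : seq_space K | mkseq h n = mkseq g n] `<=` U.
Proof.
pose G := filter_from [set: nat]
  (fun n => [set h : seq_space K | mkseq h n = mkseq g n]).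
have FG : Filter G.
  apply: filter_from_filter; first by exists 0%N.
  move=> i j _ _; exists (maxn i j) => // h /= e; split => /=.
    by rewrite -!(take_mkseq _ (leq_maxl i j)) e.
  by rewrite -!(take_mkseq _ (leq_maxr i j)) e.
suff Gg : G --> g by move=> /Gg[n _ nU]; exists n.
apply/cvg_sup => i; apply/cvg_image.
  apply/seteqP; split=> // y _; exists (fun=> y) => //.
move=> V /nbhs_singleton Vg /=.
exists [set h : seq_space K | V (h i)].
  exists i.+1 => // h /mkseq_eq/(_ i (ltnSn i)) /= ->; exact: Vg.
apply/seteqP; split=> [_ [h Vh <-]//|y Vy].
by exists (fun=> y).
Qed.

Definition cyl_closure (X : topologicalType) (K : choiceType)
    (C : set (X * seq_space K)) (s : seq K) : set X :=
  closure [set x | exists h : nat -> K, C (x, h) /\ mkseq h (size s) = s].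

Lemma cyl_closureS (X : topologicalType) (K : choiceType)
    (C D : set (X * seq_space K)) (s t : seq K) :
  C `<=` D -> cyl_closure C (s ++ t) `<=` cyl_closure D s.
Proof.
move=> CD; apply: closureS => x [h [Ch e]]; exists h; split; first exact: CD.
rewrite size_cat in e.
by rewrite -(take_mkseq _ (leq_addr (size t) (size s))) e take_size_cat.
Qed.

(** If all the closures along [g] contain [x], every box around [(x, g)] meets [C], and [C] is
    closed. *)
Lemma cyl_closureP (X : topologicalType) (K : choiceType)
    (C : set (X * seq_space K)) (x : X) (g : nat -> K) : closed C ->
  C (x, g) <-> forall n, cyl_closure C (mkseq g n) x.
Proof.
move=> cC; split=> [Cxg n|H].
  by apply: subset_closure; exists g; rewrite size_mkseq.
apply: cC => W [[U V] [/= Ux Vg] UVW].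
have [n nV] := nbhs_seq_space Vg.
have [x' [[h [Ch]]]] := H n _ Ux; rewrite size_mkseq => e Ux'.
by exists (x', h); split=> //; apply: UVW; split=> //=; exact: nV.
Qed.

(** The Suslin operation on the scheme [F], over an arbitrary index type [K]. *)
Definition tree_proj (X K : Type) (F : seq K -> set X) : set X :=
  [set x | exists g : nat -> K, forall n, F (mkseq g n) x].

Lemma Suslin_tree (X : topologicalType) (K : choiceType) (A : set X) :
  Suslin X K A -> exists F : seq K -> set X, [/\ forall s, closed (F s),
    forall s t, F (s ++ t) `<=` F s & A = tree_proj F].
Proof.
move=> [C cC <-]; exists (cyl_closure C); split.
- by move=> s; exact: closed_closure.
- by move=> s t; exact: cyl_closureS.
- apply/seteqP; split=> [_ [[x g] Cxg <-]|x [g Fg]] /=.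
    by exists g; exact/cyl_closureP.
  by exists (x, g) => //; exact/cyl_closureP.
Qed.

Lemma tree_Suslin (X : topologicalType) (K : choiceType) (F : seq K -> set X) :
  (forall s, closed (F s)) -> Suslin X K (tree_proj F).
Proof.
move=> cF; exists [set p : X * seq_space K | forall n, F (mkseq p.2 n) p.1].
  move=> -[x g] cl n /=; apply: cF => U Ux.
  have [|[x' h] [/= Fh [Ux' /= e]]] :=
      cl (U `*` [set h : seq_space K | mkseq h n = mkseq g n]).
    by exists (U, [set h : seq_space K | mkseq h n = mkseq g n]) => //=;
      split=> //; exact: nbhs_cylinder.
  by exists x'; split=> //; rewrite -e.
apply/seteqP; split=> [_ [[x g] Fg <-]|x [g Fg]]; first by exists g.
by exists (x, g).
Qed.

Lemma Suslin_surj (X : topologicalType) (K K' : choiceType) (f : K -> K') :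
  (forall y, exists x, f x = y) -> Suslin X K' `<=` Suslin X K.
Proof.
move=> fsurj A /Suslin_tree[F [cF _ ->]].
rewrite (_ : tree_proj F = tree_proj (fun s => F (map f s))).
  by apply: tree_Suslin => s; exact: cF.
have [h fh] := choice fsurj.
apply/seteqP; split=> x [g Fg].
  exists (h \o g) => n; rewrite -map_comp (_ : map _ _ = mkseq g n) //.
  by apply: eq_map => m /=; rewrite fh.
by exists (f \o g) => n; rewrite (_ : mkseq _ n = map f (mkseq g n)) // -map_comp.
Qed.

(** Each condition reads [p] only at finitely many places. Imposed on the nodes [s] long enough to
    reach past them, where the default [k0] is not read, the conditions form a scheme of closed
    sets. *)
Lemma Suslin_conditions (X : topologicalType) (K : choiceType) (k0 : K)
    (I : Type) (Phi : I -> (nat -> K) -> set X) (L : I -> seq nat) :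
  (forall c p, closed (Phi c p)) ->
  (forall c p q, {in L c, p =1 q} -> Phi c p = Phi c q) ->
  Suslin X K [set x | exists p, forall c, Phi c p x].
Proof.
move=> cPhi locPhi; pose N c := (\max_(m <- L c) m).+1.
pose F s := \bigcap_(c in [set c | (N c <= size s)%N]) Phi c (nth k0 s).
rewrite (_ : mkset _ = tree_proj F).
  by apply: tree_Suslin => s; apply: closed_bigI => c _; exact: cPhi.
have PhiN c p n : (N c <= n)%N -> Phi c (nth k0 (mkseq p n)) = Phi c p.
  move=> Nn; apply: locPhi => m mL; rewrite nth_mkseq //.
  by apply: leq_trans Nn; rewrite ltnS; exact: leq_bigmax_seq.
apply/seteqP; split=> x [p pP]; exists p.
  by move=> n c Nn; rewrite PhiN // -(size_mkseq p n).
move=> c; rewrite -(PhiN c p (N c)) //.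
by apply: pP; rewrite /mkset size_mkseq.
Qed.

(** * Borel sets are analytic and coanalytic *)

Lemma Sigma11_bigcup (X : topologicalType) (A : nat -> set X) :
  (forall i, Sigma11 X (A i)) -> Sigma11 X (\bigcup_i A i).
Proof.
move=> /(fun H i => Suslin_tree (H i)) /choice[F FP].
(* The first entry of a branch selects the set of the union. *)
pose G s := if s is i :: s' then F i s' else setT.
rewrite (_ : \bigcup_i _ = tree_proj G).
  apply: tree_Suslin => -[|i s] /=; first exact: closedT.
  by have [cF _ _] := FP i; exact: cF.
apply/seteqP; split=> x.
  move=> [i _]; have [_ _ ->] := FP i; move=> [g Fg].
  by exists (fun m => if m is m'.+1 then g m' else i) => -[|n] //; rewrite mkseq0S.
move=> [g Gg]; exists (g 0%N) => //; have [_ _ ->] := FP (g 0%N).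
by exists (fun m => g m.+1) => n; have := Gg n.+1; rewrite mkseq0S.
Qed.

(** A single sequence codes one branch for each [i] through [pickle]; the condition [(i, n)] reads
    the first [n] entries of the branch for [i]. *)
Lemma Sigma11_bigcap (X : topologicalType) (A : nat -> set X) :
  (forall i, Sigma11 X (A i)) -> Sigma11 X (\bigcap_i A i).
Proof.
move=> /(fun H i => Suslin_tree (H i)) /choice[F FP].
pose Phi (c : nat * nat) (p : nat -> nat) :=
  F c.1 (mkseq (fun m => p (pickle (c.1, m))) c.2).
rewrite (_ : \bigcap_i _ = [set x | exists p, forall c, Phi c p x]).
  apply: (@Suslin_conditions _ _ 0%N _ _
    (fun c => [seq pickle (c.1, m) | m <- iota 0 c.2])).
    by move=> c p; have [cF _ _] := FP c.1; exact: cF.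
  move=> c p q pq; rewrite /Phi; congr (F _ _); apply/mkseq_eq => m mc.
  by apply: pq; apply: map_f; rewrite mem_iota.
apply/seteqP; split=> x.
  move=> xA; have H i : exists g, forall n, F i (mkseq g n) x.
    by have := xA i I; have [_ _ ->] := FP i.
  have [g gP] := choice H.
  exists (fun m => if unpickle m is Some (i, n) then g i n else 0%N).
  move=> [i n]; rewrite /Phi /=.
  rewrite (_ : mkseq _ n = mkseq (g i) n); first exact: gP.
  by apply/mkseq_eq => m _; rewrite pickleK.
move=> [p pP] i _; have [_ _ ->] := FP i.
by exists (fun m => p (pickle (i, m))) => n; exact: (pP (i, n)).
Qed.

Lemma closed_Sigma11 (X : topologicalType) (A : set X) :
  closed A -> Sigma11 X A.
Proof.
move=> cA; rewrite (_ : A = tree_proj (fun _ : seq nat => A)).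
  exact: tree_Suslin.
by apply/seteqP; split=> x => [Ax|[_ /(_ 0%N)//]]; exists (fun=> 0%N).
Qed.

(** The sets that are both analytic and coanalytic form a sigma-algebra, which contains the open
    sets because these are F_sigma. *)
Lemma Borel_Sigma11_Pi11 (X : topologicalType) :
  (forall U : set X, open U -> Fsigma U) ->
  Borel X `<=` Sigma11 X `&` Pi11 X.
Proof.
move=> oF; apply: smallest_sub.
  split.
  - split; first by apply: closed_Sigma11; exact: closed0.
    by rewrite /Pi11 /= setC0; apply: closed_Sigma11; exact: closedT.
  - move=> A [sA pA]; rewrite setTD; split=> //.
    by rewrite /Pi11 /= setCK.
  - move=> A sA; split; first by apply: Sigma11_bigcup => i; case: (sA i).
    by rewrite /Pi11 /= setC_bigcup; apply: Sigma11_bigcap => i; case: (sA i).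
move=> U oU; split.
  have [F cF ->] := oF U oU.
  by apply: Sigma11_bigcup => i; exact: closed_Sigma11.
by apply: closed_Sigma11; exact: open_closedC.
Qed.

Lemma real_open_Fsigma (R : realType) (U : set R) : open U -> Fsigma U.
Proof.
move=> oU; exists (fun k => [set x | ball x (k.+1%:R^-1 : R)%R `<=` U]).
  move=> k x cl y /= xy.
  (* The slack in [|x - y| < 1/(k+1)]: a point [z] of the set within [e] of [x] still has [y] in its
     ball. *)
  pose e := (k.+1%:R^-1 - `|x - y|)%R.
  have e0 : (0 < e)%R by rewrite subr_gt0.
  have [z [zU zx]] := cl _ (nbhsx_ballx x e e0).
  apply: zU; rewrite /ball /= in zx *.
  rewrite (le_lt_trans (ler_distD x z y)) //.
  by rewrite distrC -ltrBrDr.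
apply/seteqP; split=> [x Ux|x [k _]]; last by apply; exact: ballxx.
have /nbhs_ballP[e e0 eU] : nbhs x U by exact: open_nbhs_nbhs.
have [k ke] : exists k : nat, (k.+1%:R^-1 < e :> R)%R.
  by have [k _ /(_ k (leqnn k))] := near_infty_natSinv_lt (PosNum e0); exists k.
exists k => // y xy; apply: eU; exact: (le_ball (ltW ke)).
Qed.

(** * Sigma^1_2 sets are aleph_1-Suslin *)

Lemma tree_branch (T : Type) (P : seq T -> Prop) :
  P [::] -> (forall s, P s -> exists i, P (rcons s i)) ->
  exists g : nat -> T, forall n, P (mkseq g n).
Proof.
move=> P0 PS; have [i0 _] := PS _ P0.
have H s : exists i, P s -> P (rcons s i).
  have [/PS[i Pi]|nP] := pselect (P s); first by exists i.
  by exists i0.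
have [next nextP] := choice H.
pose c n := iter n (fun s => rcons s (next s)) [::].
exists (fun n => next (c n)) => n.
suff -> : mkseq (fun n => next (c n)) n = c n by elim: n => //= n; exact: nextP.
by elim: n => // n IHn; rewrite mkseqS IHn.
Qed.

Lemma wf_no_descent (T : Type) (lt : T -> T -> Prop) (u : nat -> T) :
  well_founded lt -> ~ forall n, lt (u n.+1) (u n).
Proof.
move=> wf desc; suff : forall a n, u n = a -> False by move=> /(_ _ 0%N erefl).
elim/(well_founded_ind wf) => a IH n una.
by apply: (IH (u n.+1) _ n.+1 erefl); rewrite -una.
Qed.

(** Well-founded recursion: the value at [s] is a strict bound of the values at its predecessors,
    which are countably many since [S] is countable. *)
Lemma omega1_rank (K : choiceType) (lt : K -> K -> Prop) (S : countType)
    (r : S -> S -> Prop) : omega1_order lt -> well_founded r ->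
  exists f : S -> K, forall s t, r s t -> lt (f s) (f t).
Proof.
move=> ltK wfr.
have H C : exists b, countable C -> forall c, C c -> lt c b.
  have [cC|nC] := pselect (countable C).
    by have [b bP] := omega1_bounded ltK cC; exists b.
  have [b _] := omega1_bounded ltK (countable0 K).
  by exists b.
have [b bP] := choice H.
pose step s (rec : forall t, r t s -> K) :=
  b [set k | exists t (h : r t s), rec t h = k].
have stepE s (p q : forall t, r t s -> K) :
    (forall t h, p t h = q t h) -> step s p = step s q.
  move=> pq; congr (b _); apply/seteqP.
  by split=> k [t [h <-]]; exists t, h; rewrite pq.
exists (Fix wfr (fun=> K) step) => s t st; rewrite (Fix_eq wfr _ _ stepE t).
apply: bP; last by exists s, st.
apply: (@sub_countable _ _ _ (range (Fix wfr (fun=> K) step))).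
  by apply: subset_card_le => _ [u [_ <-]]; exists u.
exact: sub_countable (card_image_le _ _) (countableP _).
Qed.

Lemma Pi11_Sigma12 (X : topologicalType) : Pi11 X `<=` Sigma12 X.
Proof.
move=> A /Suslin_tree[F [cF _ FA]].
exists [set p : X * Baire_space | A p.1]; last first.
  apply/seteqP; split=> [_ [p Ap <-]//|x Ax].
  by exists (x, (fun=> 0%N) : Baire_space).
rewrite /Pi11 /= (_ : ~` _ = tree_proj (fun s => fst @^-1` F s)).
  apply: tree_Suslin => s; apply: closed_comp (cF s) => p _; exact: cvg_fst.
apply/seteqP; split=> p /=.
  by move=> nA; have : (~` A) p.1 by []; rewrite FA.
by move=> [g gP]; change ((~` A) p.1); rewrite FA; exists g.
Qed.

Lemma mkseq_cat (s : seq nat) (g : nat -> nat) n :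
  mkseq (fun m => if (m < size s)%N then nth 0%N s m else g (m - size s)%N)
    (size s + n) = s ++ mkseq g n.
Proof.
rewrite /mkseq iotaD map_cat add0n; congr (_ ++ _).
  rewrite -[RHS](mkseq_nth 0%N); apply/mkseq_eq => i -> //.
rewrite -[X in iota X]addn0 iotaDl -map_comp.
apply: eq_map => m /=.
by rewrite -ltn_subRL subnn ltn0 addKn.
Qed.

(** Above an inaccessible node, dependent choice yields an infinite sequence of inaccessible
    extensions. *)
Lemma no_branch_wf (T : seq nat -> Prop) :
  (forall s t, T (s ++ t) -> T s) -> ~ (exists g, forall n, T (mkseq g n)) ->
  well_founded (fun t' t => T t' /\ exists i, t' = rcons t i).
Proof.
set r := (X in well_founded X) => Tmon nT s0; apply: contrapT => ns0; apply: nT.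
have [||g gP] := @tree_branch _ (fun s => ~ Acc r (s0 ++ s)).
- by rewrite cats0.
- move=> s ns; apply: contrapT => /forallNP nex; apply: ns; split=> t [Tt [i ti]].
  by apply: contrapT => nt; apply: (nex i); rewrite -rcons_cat -ti.
- exists (fun m => if (m < size s0)%N then nth 0%N s0 m else g (m - size s0)%N).
  move=> n; set g' := (X in mkseq X).
  (* An inaccessible node has a child in [T], so it lies in [T] by [Tmon]. *)
  have Tn : T (mkseq g' (size s0 + n.+1)).
    rewrite mkseq_cat; apply: contrapT => nTn; apply: (gP n.+1).
    split=> t [Tt [i ti]]; exfalso; apply: nTn.
    by apply: (Tmon _ [:: i]); rewrite cats1 -ti.
  apply: (Tmon _ (drop n (mkseq g' (size s0 + n.+1)))).
  rewrite -(@take_mkseq _ g' n (size s0 + n.+1)) ?cat_take_drop //.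
  by rewrite (leq_trans (leqnSn n)) // leq_addl.
Qed.

(* The witnesses are a point [w] of the Baire space, a rank function [f] into
   omega1 on the tree that searches for a point of the analytic complement over
   [(x, w)], and, for each node [t] off that tree, an index [k t] of one of the
   closed sets whose union is the open set of those [x] which exclude [t]. *)
Lemma Sigma12_Suslin (X : topologicalType) (K : choiceType)
    (lt : K -> K -> Prop) :
  (forall U : set X, open U -> Fsigma U) -> omega1_order lt ->
  Sigma12 X `<=` Suslin X K.
Proof.
move=> oF ltK _ [B /Suslin_tree[F [cF Fmon FB]] <-].
have [wfK _ _ _ ucK] := ltK.
have [k0 _] := omega1_bounded ltK (countable0 K).
(* Each entry of a witness carries a value of [w], one of [k] and one of [f], the last two at the
   node with that code. *)
have [f0 f0P] : exists f : K -> nat * option nat * K, forall y, exists x, f x = y.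
  apply: (embeds_surj (0%N, None, k0)).
  apply: embeds_trans (uncountable_embeds_mul_nat ucK).
  exists (fun p => (p.2, pickle p.1)) => -[p a] [q b] /= [-> e].
  by rewrite (pcan_inj pickleK e).
apply: (Suslin_surj f0P).
pose G t u := cyl_closure (F t) u.
have Gmon s t u v : G (s ++ t) (u ++ v) `<=` G s u.
  by apply: cyl_closureS; exact: Fmon.
have H tu : exists H : nat -> set X,
    (forall j, closed (H j)) /\ ~` G tu.1 tu.2 = \bigcup_j H j.
  have [|H cH HE] := oF (~` G tu.1 tu.2); last by exists H.
  by apply: closed_openC; exact: closed_closure.
have {H}[H HP] := choice H.
(* From right to left, the lengths [n] for [g] and [m] for [w] are both dominated by their maximum,
   and [G] is monotone. *)
have notB x w : ~ B (x, w) <-> exists g, forall n, G (mkseq g n) (mkseq w n) x.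
  rewrite -[~ _]/((~` B) (x, w)) FB; split=> -[g gP]; exists g.
    by move=> n; have /(cyl_closureP _ _ (cF _))/(_ n) := gP n.
  move=> n; apply/cyl_closureP => // m.
  have := gP (maxn n m).
  rewrite -(cat_take_drop n (mkseq g _)) -(cat_take_drop m (mkseq w _)).
  by rewrite !take_mkseq ?leq_maxl ?leq_maxr //; exact: Gmon.
pose w_ (p : nat -> nat * option nat * K) m := (p m).1.1.
pose k_ (p : nat -> nat * option nat * K) (t : seq nat) := (p (pickle t)).1.2.
pose f_ (p : nat -> nat * option nat * K) (t : seq nat) := (p (pickle t)).2.
(* [Some j] certifies that [t] is off the search tree. [None] demands that the rank drop from the
   parent to [t], which does not involve [x], so the set is everything or empty. *)
pose Phi (c : seq nat * nat) p : set X := let t := rcons c.1 c.2 in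
  if k_ p t is Some j then H (t, mkseq (w_ p) (size t)) j
  else if `[< lt (f_ p t) (f_ p c.1) >] then setT else set0.
rewrite (_ : fst @` B = [set x | exists p, forall c, Phi c p x]).
  apply: (@Suslin_conditions _ _ (0%N, None, k0) _ _ (fun c =>
    iota 0 (size c.1).+1 ++ [:: pickle c.1; pickle (rcons c.1 c.2)])).
    move=> c p; rewrite /Phi; case: (k_ p _) => [j|].
      by have [cH _] := HP (rcons c.1 c.2, mkseq (w_ p) (size (rcons c.1 c.2))).
    by case: ifP => _; [exact: closedT|exact: closed0].
  move=> [t i] p q pq; rewrite /Phi /k_ /f_ /= -!pq ?mem_cat ?inE ?eqxx ?orbT //.
  case: (p _).1.2 => // j; congr (H (_, _) _); apply/mkseq_eq => m.
  rewrite size_rcons => mt; rewrite /w_ pq //.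
  by rewrite mem_cat mem_iota mt.
apply/seteqP; split=> x.
  move=> [[{}x w] Bxw <-] /=.
  (* As [(x, w)] lies in [B], this search tree has no branch and is ranked into omega_1. *)
  pose T t := G t (mkseq w (size t)) x.
  have Tmon s t : T (s ++ t) -> T s.
    rewrite /T size_cat -(cat_take_drop (size s) (mkseq w _)).
    by rewrite take_mkseq ?leq_addr //; exact: Gmon.
  have wfT := no_branch_wf Tmon.
  have [|f fP] := omega1_rank ltK (wfT _).
    move=> [g gP]; suff : ~ B (x, w) by [].
    by apply/notB; exists g => n; have := gP n; rewrite /T size_mkseq.
  have E t : exists k : option nat,
      if k is Some j then H (t, mkseq w (size t)) j x else T t.
    have [Tt|nT] := pselect (T t); first by exists None.
    have [_ HE] := HP (t, mkseq w (size t)).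
    have : (~` G t (mkseq w (size t))) x by [].
    by rewrite HE => -[j _ Hj]; exists (Some j).
  have [k kP] := choice E.
  pose p m := (w m, if unpickle m is Some t then k t else None,
                    if unpickle m is Some t then f t else k0).
  exists p => -[t i].
  have kE s : k_ p s = k s by rewrite /k_ /p pickleK.
  have fE s : f_ p s = f s by rewrite /f_ /p pickleK.
  rewrite /Phi kE !fE.
  have := kP (rcons t i); case: (k _) => [j //|Tt].
  by rewrite asboolT //; apply: fP; split=> //; exists i.
(* Otherwise the search tree has a branch [g]; no node on it can be certified off the tree, so the
   ranks descend forever along [g]. *)
move=> [p pP]; exists (x, w_ p) => //; apply: contrapT => /notB[g gP].
apply: (@wf_no_descent _ lt (fun n => f_ p (mkseq g n)) wfK) => n.
have := pP (mkseq g n, g n); rewrite /Phi /= -mkseqS.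
case: (k_ p _) => [j Hj|]; last by case: asboolP.
have [_ HE] := HP (mkseq g n.+1, mkseq (w_ p) (size (mkseq g n.+1))).
have : (\bigcup_j H (mkseq g n.+1, mkseq (w_ p) (size (mkseq g n.+1))) j) x.
  by exists j.
by rewrite -HE; case; rewrite size_mkseq; exact: gP.
Qed.

(** * Suslin sets as unions of Borel sets *)

Lemma Borel_setC (X : topologicalType) (A : set X) :
  Borel X A -> Borel X (~` A).
Proof. by move=> bA; rewrite -setTD; exact: sigma_algebraCD. Qed.

Lemma Borel_bigcup (X : topologicalType) (I : Type) (D : set I)
    (F : I -> set X) : countable D -> (forall i, D i -> Borel X (F i)) ->
  Borel X (\bigcup_(i in D) F i).
Proof.
move=> /countable_injP[f fI] bF.
rewrite (_ : \bigcup_(i in D) F i =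
    \bigcup_n \bigcup_(i in D `&` [set i | f i = n]) F i).
  apply: sigma_algebra_bigcup => n.
  have [[i [Di fi]]|nD] := pselect (exists i, D i /\ f i = n).
    rewrite (_ : D `&` _ = [set i]) ?bigcup_set1; first exact: bF.
    apply/seteqP; split=> [j [Dj /= fj]|_ ->//].
    by apply: fI; rewrite ?inE // fj.
  rewrite (_ : D `&` _ = set0) ?bigcup_set0; first exact: sigma_algebra0.
  by rewrite -subset0 => i [Di fi]; apply: nD; exists i.
apply/seteqP; split=> [x [i Di Fx]|x [n _ [i [Di _] Fx]]]; last by exists i.
by exists (f i) => //; exists i.
Qed.

Lemma Borel_bigcap (X : topologicalType) (I : Type) (D : set I)
    (F : I -> set X) : countable D -> (forall i, D i -> Borel X (F i)) ->
  Borel X (\bigcap_(i in D) F i).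
Proof.
move=> cD bF; rewrite -[X in Borel _ X]setCK setC_bigcap; apply: Borel_setC.
by apply: Borel_bigcup => // i Di; apply: Borel_setC; exact: bF.
Qed.

Lemma Borel_setI (X : topologicalType) (A B : set X) :
  Borel X A -> Borel X B -> Borel X (A `&` B).
Proof.
move=> bA bB; rewrite (_ : A `&` B = \bigcap_(b in [set: bool]) if b then A else B).
  by apply: Borel_bigcap => // -[].
by apply/seteqP; split=> [x [Ax Bx] []//|x H]; split; [exact: (H true)|exact: (H false)].
Qed.

Lemma closed_Borel (X : topologicalType) (A : set X) : closed A -> Borel X A.
Proof.
move=> cA; rewrite -(setCK A); apply: Borel_setC; apply: sub_sigma_algebra.
exact: closed_openC.
Qed.

Section BorelUnions.
Variables (X : topologicalType) (K : choiceType) (lt : K -> K -> Prop).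
Hypothesis ltK : omega1_order lt.

(* [S a s] is the set of the [x] such that [s] survives [a] prunings of the
   tree [[set t | F t x]]. *)
Lemma iterated_pruning (F : seq nat -> set X) :
  exists S : K -> seq nat -> set X, forall a s,
    S a s = F s `&` \bigcap_(b in [set b | lt b a]) \bigcup_i S b (rcons s i).
Proof.
have [wf _ _ _ _] := ltK.
pose step a (rec : forall b, lt b a -> seq nat -> set X) s :=
  F s `&` [set x | forall b (h : lt b a), exists i, rec b h (rcons s i) x].
have stepE a (p q : forall b, lt b a -> seq nat -> set X) :
    (forall b h, p b h = q b h) -> step a p = step a q.
  move=> pq; apply/funext => s; congr (_ `&` _); apply/seteqP.
  by split=> x H b h; have [i Hi] := H b h; exists i; rewrite ?pq // -pq.
exists (Fix wf (fun=> seq nat -> set X) step) => a s.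
rewrite {1}(Fix_eq wf _ _ stepE a); congr (_ `&` _); apply/seteqP; split=> x H b h.
  by have [i Hi] := H b h; exists i.
by have [i _ Hi] := H b h; exists i.
Qed.

Lemma tree_proj_Borel_union (F : seq nat -> set X) :
  (forall s, Borel X (F s)) ->
  exists E : K -> set X, (forall a, Borel X (E a)) /\ tree_proj F = \bigcup_a E a.
Proof.
move=> bF; have [wf tr tri segK ucK] := ltK.
have [S SE] := iterated_pruning F.
have bS a s : Borel X (S a s).
  elim/(well_founded_ind wf) : a s => a IH s; rewrite SE.
  apply: Borel_setI => //; apply: Borel_bigcap => // b ba.
  by apply: Borel_bigcup => // i _; exact: IH.
have Smon b a s : lt b a -> S a s `<=` S b s.
  move=> ba x; rewrite !SE => -[Fx Sx]; split=> // c cb.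
  by apply: Sx; exact: tr ba.
(* The root survives to stage [a], and every node alive then has a child alive then. *)
pose E a := S a [::] `&`
  \bigcap_(s in [set: seq nat]) (~` S a s `|` \bigcup_i S a (rcons s i)).
exists E; split.
  move=> a; apply: Borel_setI => //; apply: Borel_bigcap => // s _.
  rewrite -[X in Borel _ X]setCK setCU setCK; apply: Borel_setC.
  apply: Borel_setI => //; apply: Borel_setC.
  by apply: Borel_bigcup.
apply/seteqP; split=> x.
  move=> [g gP].
  have gS a n : S a (mkseq g n) x.
    elim/(well_founded_ind wf) : a n => a IH n; rewrite SE; split; first exact: gP.
    by move=> b ba; exists (g n) => //; rewrite -mkseqS; exact: IH.
  (* [h s] is a stage at which [s] is gone, if it ever goes. The nodes are countably many, so some
     [a] bounds all these stages. *)
  have H s : exists a, (exists b, ~ S b s x) -> ~ S a s x.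
    have [[b nb]|n] := pselect (exists b, ~ S b s x); first by exists b.
    have [b _] := omega1_bounded ltK (countable0 K).
    by exists b => /n.
  have [h hP] := choice H.
  have [a aP] := omega1_bounded ltK (sub_countable (card_image_le h setT) (countableP _)).
  exists a => //; split; first exact: (gS a 0%N).
  move=> s _; have [Sas|] := pselect (S a s x); [right|by left].
  (* A node alive at [a] is alive at every stage; being alive at some [c] above [a] gives it a child
     alive at [a]. *)
  have allS b : S b s x.
    apply: contrapT => nb; have hs : ~ S (h s) s x by apply: hP; exists b.
    by apply: hs; apply: Smon Sas; apply: aP; exists s.
  have [c cP] := omega1_bounded ltK (countable1 a).
  have := allS c; rewrite SE => -[_ /(_ a)]; apply.
  exact: cP.
move=> [a _ [S0 SP]].
have [||g gP] := @tree_branch _ (fun s => S a s x) => //.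
  by move=> s Ss; have [//|[i _ Si]] := SP s I; exists i.
by exists g => n; have := gP n; rewrite SE => -[].
Qed.

Lemma omega1_enum_le b : exists d : nat -> K,
  range d = [set c | c = b \/ lt c b].
Proof.
have /pfcard_geP[e|[d]] := omega1_countable_le ltK b.
  by have : [set c | c = b \/ lt c b] b by [left]; rewrite e.
exists d; apply/seteqP; split=> [_ [n _ <-]|]; first exact: funS.
exact: (surj (f := d)).
Qed.

(** A branch in omega_1 stays below some [b], and an enumeration of the segment up to [b] turns the
    branches below [b] into branches over [nat]. A surjection of [K] onto the pairs [(b, a)] merges
    the resulting families. *)
Lemma Suslin_Borel_union (A : set X) : Suslin X K A ->
  exists E : K -> set X, (forall a, Borel X (E a)) /\ A = \bigcup_a E a.
Proof.
move=> /Suslin_tree[F [cF _ ->]].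
have [k0 _] := omega1_bounded ltK (countable0 K).
have [d dP] := choice omega1_enum_le.
have H b := tree_proj_Borel_union (F := fun s => F (map (d b) s))
  (fun s => closed_Borel (cF _)).
have [E EP] := choice H.
have [c cP] := embeds_surj (k0, k0) (omega1_mul ltK).
exists (fun k => E (c k).1 (c k).2); split.
  by move=> k; have [bE _] := EP (c k).1; exact: bE.
apply/seteqP; split=> x.
  move=> [g gP].
  have [b bP] := omega1_bounded ltK (sub_countable (card_image_le g setT) (countableP _)).
  have G n : exists m, d b m = g n.
    have : range (d b) (g n) by rewrite dP; right; apply: bP; exists n.
    by move=> [m _ <-]; exists m.
  have [g' g'P] := choice G.
  have : tree_proj (fun s => F (map (d b) s)) x.
    exists g' => n; rewrite -map_comp (_ : map _ _ = mkseq g n) //.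
    by apply: eq_map => m /=.
  have [_ ->] := EP b => -[a _ Ea]; have [k kP] := cP (b, a).
  by exists k => //; rewrite kP.
move=> [k _ Ek]; have [_ EE] := EP (c k).1.
have : tree_proj (fun s => F (map (d (c k).1) s)) x by rewrite EE; exists (c k).2.
move=> [g gP]; exists (d (c k).1 \o g) => n.
by rewrite (_ : mkseq _ n = map (d (c k).1) (mkseq g n)) // -map_comp.
Qed.

Lemma Suslin_Borel_partition (A : set X) : Suslin X K A ->
  exists E : K -> set X,
    [/\ forall a, Borel X (E a), trivIset setT E & A = \bigcup_a E a].
Proof.
move=> /Suslin_Borel_union[E [bE ->]]; have [wf tr tri segK _] := ltK.
(* Each point is kept only at its least index; some pieces may become empty. *)
exists (fun a => E a `&` ~` \bigcup_(b in [set b | lt b a]) E b); split.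
- move=> a; apply: Borel_setI => //; apply: Borel_setC.
  by apply: Borel_bigcup.
- move=> a b _ _ [x [[Ea na] [Eb nb]]]; have [//|ab|ba] := tri a b.
  + by case: nb; exists a.
  + by case: na; exists b.
apply/seteqP; split=> [x [a _ Ea]|x [a _ [Ea _]]]; last by exists a.
elim/(well_founded_ind wf) : a Ea => a IH Ea.
have [[b ba Eb]|n] := pselect ((\bigcup_(b in [set b | lt b a]) E b) x).
  exact: IH Eb.
by exists a.
Qed.

End BorelUnions.

(** * Refining partitions *)

Lemma sub_sp (X : topologicalType) (Gamma Delta : set (set X)) :
  Gamma `<=` Delta -> sp Gamma `<=` sp Delta.
Proof.
move=> GD _ [P [pP ucP PG] <-]; exists P => //; split=> //.
exact: subset_trans GD.
Qed.

Lemma sp_refine (X : topologicalType) (K : choiceType) (lt : K -> K -> Prop)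
    (Gamma Delta : set (set X)) : omega1_order lt ->
  (forall A, Gamma A -> exists E : K -> set X,
    [/\ forall a, Delta (E a), trivIset setT E & A = \bigcup_a E a]) ->
  sp Gamma `<=` sp Delta.
Proof.
move=> ltK GD _ [P [[Pcov Ptriv Pn0] ucP PG] <-].
have [k0 _] := omega1_bounded ltK (countable0 K).
have H A : exists E : K -> set X, P A ->
    [/\ forall a, Delta (E a), trivIset setT E & A = \bigcup_a E a].
  have [/PG/GD[E EP]|nP] := pselect (P A); first by exists E.
  by exists (fun=> set0).
have [E EP] := choice H.
have Esub A a : P A -> E A a `<=` A.
  by move=> PA; have [_ _ {2}->] := EP _ PA; exact: bigcup_sup.
(* Empty pieces are discarded, as a partition has nonempty members. *)
pose Q := [set B | exists A a, [/\ P A, E A a = B & B !=set0]].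
have QP : Q #= P.
  apply/card_eqPle; split; apply/card_le_embeds.
    have [ucK _] := omega1_is_aleph1 ltK.
    (* If instead [P] embeds in [K], its image is uncountable and so has the size of [K]. With [K]
       inside [P], the product [P * K] is absorbed by [P]. *)
    have KP : embeds K P.
      have [//|[f fI]] := embeds_total K P.
      have /inj_card_eq fP : {in [set: P] &, injective f} by move=> x y _ _; exact: fI.
      have [_ /(_ (range f))[cf|]] := omega1_is_aleph1 ltK.
        by case: ucP; rewrite -(eq_countable (card_setT P)) -(eq_countable fP).
      by rewrite (card_eql fP) => /card_eqPle[_ /embeds_setT].
    apply: (@embeds_trans (P * K)); last first.
      apply: (embeds_absorb _ (omega1_mul ltK) KP).
      apply: embeds_trans (uncountable_embeds_nat ucK).
      by exists nat_of_bool; case=> -[].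
    have code (B : Q) : exists p : P * K, E (val p.1) p.2 = val B.
      have [A [a [PA EB _]]] := set_valP B.
      by exists (SigSub (mem_set PA), a).
    have [c cP] := choice code.
    by exists c => B B' cBB'; apply: val_inj; rewrite -!cP cBB'.
  (* Each member of [P] contains a piece, and disjointness makes the choice of one injective. *)
  have code (A : P) : exists B : Q, val B `<=` val A.
    have PA := set_valP A.
    have [x Ax] := Pn0 _ PA; have [_ _ AE] := EP _ PA.
    have [a _ Ea] : (\bigcup_a E (val A) a) x by rewrite -AE.
    have QE : Q (E (val A) a) by exists (val A), a; split=> //; exists x.
    by exists (SigSub (mem_set QE)) => /=; exact: Esub.
  have [c cP] := choice code.
  exists c => A A' cAA'; apply: val_inj.
  have [_ [_ [_ _ [x Bx]]]] := set_valP (c A).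
  apply: (Ptriv _ _ (set_valP A) (set_valP A')); exists x; split.
    exact: cP.
  by apply: cP; rewrite -cAA'.
exists Q; last first.
  apply/seteqP; split=> B /=; rewrite /cardinality /= => BQ.
    exact: card_eq_trans BQ QP.
  by apply: card_eq_trans BQ _; exact: card_esym.
split; last first.
- by move=> B [A [a [PA <- _]]]; have [] := EP _ PA.
- by rewrite (eq_countable QP).
split.
- apply/seteqP; split=> // x _.
  have [A PA Ax] : cover P id x by rewrite Pcov.
  have [_ _ AE] := EP _ PA; rewrite AE in Ax; have [a _ Ea] := Ax.
  by exists (E A a) => //; exists A, a; split=> //; exists x.
- move=> _ _ [A [a [PA <- _]]] [A' [a' [PA' <- _]]] [x [xE xE']].
  have AA' : A = A' by apply: Ptriv => //; exists x; split; exact: Esub xE || exact: Esub xE'.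
  rewrite -AA' in xE' *; have [_ Etriv _] := EP _ PA.
  by congr (E A _); apply: Etriv => //; exists x.
- by move=> B [A [a []]].
Qed.

(** Cantor's diagonal argument; it supplies an uncountable type from which omega_1 is cut out. *)
Lemma uncountable_set_nat : ~ countable [set: set nat].
Proof.
move=> /embeds_setT[f fI].
pose D := [set n | exists A : set nat, f A = n /\ ~ A n].
have [Df|nDf] := pselect (D (f D)); last by apply: (nDf); exists D.
by have [A [/fI AD]] := Df; rewrite AD.
Qed.

Theorem theorem5p2 (R : realType) :
  [/\ sp (Borel R) = sp (Sigma11 R),
      sp (Sigma11 R) = sp (Pi11 R),
      sp (Pi11 R) = sp (Sigma12 R)
    & sp (Sigma12 R) = sp (aleph1_Suslin R)].
Proof.
have [K [lt [ltK _]]] := omega1_exists uncountable_set_nat.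
have oF : forall U : set R, open U -> Fsigma U := @real_open_Fsigma R.
have SuslinK : Suslin R K `<=` aleph1_Suslin R.
  by move=> A AK; exists K => //; exact: omega1_is_aleph1 ltK.
have Suslin_to_Borel : sp (aleph1_Suslin R) `<=` sp (Borel R).
  apply: (sp_refine ltK) => A [K' K'1 AK']; apply: (Suslin_Borel_partition ltK).
  by have [f fP] := is_aleph1_surj ltK K'1; exact: Suslin_surj fP _ AK'.
have collapse Gamma : Borel R `<=` Gamma -> Gamma `<=` aleph1_Suslin R ->
    sp Gamma = sp (Borel R).
  move=> BG GS; apply/seteqP; split; last exact: sub_sp.
  exact: subset_trans (sub_sp GS) Suslin_to_Borel.
have BorelS : Borel R `<=` Sigma11 R by move=> A /(Borel_Sigma11_Pi11 oF)[].
have BorelP : Borel R `<=` Pi11 R by move=> A /(Borel_Sigma11_Pi11 oF)[].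
have Sigma12S : Sigma12 R `<=` aleph1_Suslin R.
  exact: subset_trans (Sigma12_Suslin oF ltK) SuslinK.
(* Analytic sets are the [nat]-Suslin sets, and omega_1 maps onto [nat]. *)
have Sigma11S : Sigma11 R `<=` aleph1_Suslin R.
  have [_ _ _ _ ucK] := ltK.
  have [f fP] := embeds_surj 0%N (uncountable_embeds_nat ucK).
  exact: subset_trans (Suslin_surj fP) SuslinK.
have BorelS2 : Borel R `<=` Sigma12 R := subset_trans BorelP (@Pi11_Sigma12 R).
have Pi11S : Pi11 R `<=` aleph1_Suslin R.
  exact: subset_trans (@Pi11_Sigma12 R) Sigma12S.
have BorelA : Borel R `<=` aleph1_Suslin R := subset_trans BorelP Pi11S.
have := (collapse _ BorelS Sigma11S, collapse _ BorelP Pi11S,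
         collapse _ BorelS2 Sigma12S, collapse _ BorelA (@subset_refl _ _)).
by move=> [[[-> ->] ->] ->].
Qed.
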